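(* Every deterministic online algorithm for minimizing total weighted completion time $\sum_j w_j C_j$ on a single machine with preemption, where each job $J_j$ has release date $r_j\ge 0$, processing time $p_j>0$ and weight $w_j\ge 0$ and becomes known only at its release date, has competitive ratio at least $1.1038$.
   Context: Preemption means a job may be interrupted and resumed later without any change of its total processing time. The competitive ratio of an online algorithm is the supremum over all instances of the total weighted completion time of its schedule divided by the total weighted completion time of an optimal offline preemptive schedule of the same instance. The value $1.1038$ is given rounded to four decimal places. *)

(* Defs.v *)
From mathcomp Require Import all_boot all_order all_algebra.
From mathcomp Require Import all_classical all_reals all_analysis.
Set Implicit Arguments. Unset Strict Implicit. Unset Printing Implicit Defensive.
Import Order.TTheory GRing.Theory Num.Theory.
Local Open Scope classical_set_scope.
Local Open Scope ring_scope.

Section Sched.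
Variable R : realType.

Record job := Job { rel : R; ptime : R; wt : R }.

Definition valid_job (j : job) : Prop := 0 <= rel j /\ 0 < ptime j /\ 0 <= wt j.

(* An instance: jobs are identified by their position (a natural-number
   label); [None] entries are absent labels.  The algorithm never learns the
   length of the list beyond what the online condition allows. *)
Definition inst := seq (option job).

Definition job_at (I : inst) (k : nat) : option job := nth None I k.

Definition valid_inst (I : inst) : Prop :=
  forall k j, job_at I k = Some j -> valid_job j.

(* A (preemptive) single machine schedule: at each time the machine processes
   at most one job (given by its label) or idles. *)
Definition schedule := R -> option nat.

Definition proc_set (S : schedule) (k : nat) : set R := [set t | S t = Some k].

Definition feasible (I : inst) (S : schedule) : Prop :=
  (forall t k, S t = Some k -> exists j, job_at I k = Some j /\ rel j <= t) /\
  (forall k j, job_at I k = Some j ->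
     measurable (proc_set S k : set (measurableTypeR R)) /\
     lebesgue_measure (proc_set S k : set (measurableTypeR R)) = (ptime j)%:E /\
     exists T : R, forall t, S t = Some k -> t <= T).

Definition completion (S : schedule) (k : nat) (p : R) : R :=
  inf [set t : R | lebesgue_measure
         ((proc_set S k `&` `]-oo, t]) : set (measurableTypeR R)) = p%:E].

Definition cost (I : inst) (S : schedule) : R :=
  \sum_(k < size I)
     match job_at I k with
     | Some j => wt j * completion S k (ptime j)
     | None => 0
     end.

Definition OPT (I : inst) : R :=
  inf [set x : R | exists S, feasible I S /\ x = cost I S].

Definition released (o : option job) (t : R) : option job :=
  match o with
  | Some j => if rel j <= t then Some j else None
  | None => None
  end.

Definition online (A : inst -> schedule) : Prop :=
  forall (I I' : inst) (t : R), valid_inst I -> valid_inst I' ->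
    (forall k, released (job_at I k) t = released (job_at I' k) t) ->
    forall s, s < t -> A I s = A I' s.

Definition online_algorithm (A : inst -> schedule) : Prop :=
  online A /\ forall I, valid_inst I -> feasible I (A I).

End Sched.

(* Main.v *)
(* The adversary starts with a short job of size 38 and weight 37 and a long job
   of size 100 and weight 100, of almost equal densities. An algorithm that
   favours the long job has not finished the short one at time 38; one that
   favours the short job has not finished the long one at time 100. Either way it
   holds a half-processed job at a date when the optimum can just have completed
   one job. At that date two further jobs, again of nearly equal densities,
   repeat the dilemma, and a last dense job punishes what the algorithm has left
   unfinished, while the optimum has completed exactly one job of each pair.

   The cost of the algorithm is bounded below through the remaining processing
   times at the last decision: each pair of unfinished jobs costs at least the
   cheaper of its two orders. This bound is a concave function of the amounts
   processed so far, so time sharing between jobs does not help the algorithm. *)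
Require Import Defs.
From mathcomp Require Import all_boot all_order all_algebra.
From mathcomp Require Import all_classical all_reals all_analysis.
From mathcomp Require Import lra.
Set Implicit Arguments. Unset Strict Implicit. Unset Printing Implicit Defensive.
Import Order.TTheory GRing.Theory Num.Theory.
Local Open Scope classical_set_scope.
Local Open Scope ring_scope.

(** * Processed amounts and completion times *)

Section Work.
Variable R : realType.
Implicit Types (S : schedule R) (I : inst R).

Local Notation mu := (@lebesgue_measure R).

(** Asked of every label, absent ones included, so that facts about processed amounts need no
    reference to an instance. *)
Definition measurable_schedule S :=
  forall k, measurable (proc_set S k : set (measurableTypeR R)) /\
    (mu (proc_set S k : set (measurableTypeR R)) < +oo)%E.

Definition work S k (t : R) : R :=
  fine (mu (proc_set S k `&` `]-oo, t])).

Lemma feasible_measurable I S : feasible I S -> measurable_schedule S.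
Proof.
move=> [relS procS] k; case E : (job_at I k) => [j|].
  by have [? [-> _]] := procS _ _ E; split=> //; rewrite ltry.
have -> : proc_set S k = set0.
  by apply/seteqP; split=> // t /relS[j []]; rewrite E.
by rewrite measure0; split=> //; exact: measurable0.
Qed.

Section MeasurableSchedule.
Variables (S : schedule R) (mS : measurable_schedule S).

Let mproc k : measurable (proc_set S k : set (measurableTypeR R)).
Proof. by have [] := mS k. Qed.

Let mproc_itv k (i : interval R) :
  measurable (proc_set S k `&` [set` i] : set (measurableTypeR R)).
Proof. exact: measurableI. Qed.

Let fin_proc_itv k (i : interval R) :
  mu (proc_set S k `&` [set` i]) \is a fin_num.
Proof.
rewrite ge0_fin_numE//; apply: le_lt_trans (mS k).2.
apply: le_measure; rewrite ?inE//; by [exact: mproc_itv|exact: subIsetl].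
Qed.

Lemma work_ge0 k t : 0 <= work S k t.
Proof. exact: fine_ge0. Qed.

Lemma workE k t : mu (proc_set S k `&` `]-oo, t]) = (work S k t)%:E.
Proof. by rewrite /work fineK. Qed.

Lemma workB k t t' : t <= t' ->
  work S k t' - work S k t = fine (mu (proc_set S k `&` `]t, t'])).
Proof.
move=> tt'; apply/eqP; rewrite subr_eq addrC /work -fineD//.
have dj : (proc_set S k `&` `]-oo, t]) `&` (proc_set S k `&` `]t, t']) = set0.
  rewrite setIACA setIid -subset0 => x [_ []] /=.
  by rewrite !in_itv/= => xt /andP[tx _]; move: xt; rewrite leNgt tx.
rewrite -(measureU mu (mproc_itv _ _) (mproc_itv _ _) dj) -setIUr.
by apply/eqP; congr (fine (mu (_ `&` _))); rewrite -itv_bndbnd_setU// bnd_simp.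
Qed.

Lemma work_le k t t' : t <= t' -> work S k t <= work S k t'.
Proof. by move=> tt'; rewrite -subr_ge0 workB//; exact: fine_ge0. Qed.

(** A schedule picks at most one job at each instant, so the processing sets of distinct labels are
    disjoint. The induction takes the part used by [k] out of [B]. *)
Let sum_mu_proc (U : seq nat) (B : set (measurableTypeR R)) : uniq U -> measurable B ->
  (\sum_(k <- U) mu (proc_set S k `&` B) <= mu B)%E.
Proof.
elim: U B => [|k U IH] B /=; first by rewrite big_nil measure_ge0.
move=> /andP[kU uU] mB; rewrite big_cons.
have mBk : measurable (B `\` proc_set S k) by exact: measurableD.
rewrite (measureDI mu mB (mproc k)) setIC addeC leeD2r //.
rewrite (le_trans _ (IH _ uU mBk))// le_eqVlt; apply/orP; left; apply/eqP.
apply: eq_big_seq => j jU; congr (mu _); apply/seteqP; split=> t []/= tj tB.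
  by split=> //; split=> //; rewrite /proc_set/= tj => -[jk]; move: kU; rewrite -jk jU.
by case: tB.
Qed.

(** The machine has unit speed. Every bound on the total work done by a decision date comes from
    here. *)
Lemma sum_work_le (U : seq nat) t t' : uniq U -> t <= t' ->
  \sum_(k <- U) (work S k t' - work S k t) <= t' - t.
Proof.
move=> uU tt'; rewrite -lee_fin -sumEFin.
under eq_bigr do rewrite workB// fineK//.
apply: le_trans (sum_mu_proc uU _) _ => //.
by rewrite lebesgue_measure_itv/= lte_fin; case: ltP => // _; rewrite lee_fin subr_ge0.
Qed.

Lemma work_lipschitz k t t' : t <= t' -> work S k t' <= work S k t + (t' - t).
Proof.
by move=> tt'; have := @sum_work_le [:: k] t t' isT tt'; rewrite big_seq1; lra.
Qed.

End MeasurableSchedule.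
End Work.

Section Feasible.
Variable R : realType.
Implicit Types (S : schedule R) (I : inst R) (js : seq (job R)).
Local Notation mu := (@lebesgue_measure R).

(** A single instant has measure zero. The open half-line suits the online condition, which fixes
    schedules only strictly before a date. *)
Lemma work_lt S k t : measurable_schedule S ->
  work S k t = fine (mu (proc_set S k `&` `]-oo, t[)).
Proof.
move=> mS; rewrite /work; congr fine.
have mk := (mS k).1.
have -> : proc_set S k `&` `]-oo, t] =
          (proc_set S k `&` `]-oo, t[) `|` (proc_set S k `&` [set t]).
  by rewrite -setIUr; congr (_ `&` _); rewrite setUitv1.
apply: measureU0.
- by apply: measurableI.
- by apply: measurableI.
- by apply: (@subset_measure0 _ _ _ mu _ [set t]) => //;
    [exact: measurableI|exact: lebesgue_measure_set1].
Qed.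

Lemma work_ext S S' k t : measurable_schedule S -> measurable_schedule S' ->
  (forall s, s < t -> S s = S' s) -> work S k t = work S' k t.
Proof.
move=> mS mS' SS'; rewrite !work_lt//; congr (fine (mu _)).
by apply/seteqP; split=> s [] /= sk; rewrite in_itv/= => st; split=> //=;
  move: sk; rewrite /proc_set/= SS'.
Qed.

Section OneJob.
Variables (I : inst R) (S : schedule R) (feasS : feasible I S).
Variables (k : nat) (j : job R) (Ikj : job_at I k = Some j).

Let mS : measurable_schedule S := feasible_measurable feasS.

Let muk : mu (proc_set S k) = (ptime j)%:E.
Proof. by have [_ [-> _]] := feasS.2 _ _ Ikj. Qed.

Lemma work_le_ptime t : work S k t <= ptime j.
Proof.
rewrite -lee_fin -workE// -muk; apply: le_measure; rewrite ?inE.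
- by apply: measurableI => //; exact: (mS k).1.
- exact: (mS k).1.
- exact: subIsetl.
Qed.

Lemma work_before_release t : t <= Defs.rel j -> work S k t = 0.
Proof.
move=> tj; rewrite work_lt//.
have -> : proc_set S k `&` `]-oo, t[ = set0; last by rewrite measure0.
rewrite -subset0 => s [/(feasS.1 s k)[i [Ii si]]] /=.
by rewrite in_itv/=; move: Ii si; rewrite Ikj => -[<-] ? ?; lra.
Qed.

Let E := [set t : R | mu ((proc_set S k `&` `]-oo, t]) : set (measurableTypeR R))
                       = (ptime j)%:E].

Let EP t : E t <-> work S k t = ptime j.
Proof. by rewrite /E/= workE//; split=> [[]|->]. Qed.

Hypothesis pj : 0 < ptime j.

Let E_ge t : E t -> Defs.rel j <= t.
Proof.
move=> /EP wt; rewrite leNgt; apply/negP => /ltW tj.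
by move: wt; rewrite work_before_release// => p0; move: pj; rewrite -p0 ltxx.
Qed.

Let E0 : E !=set0.
Proof.
have [_ [_ [T ST]]] := feasS.2 _ _ Ikj.
(* The bound on processing dates in [feasible] provides a date by which all the work is done. *)
exists T; rewrite /E/= -muk; congr (mu _); apply/seteqP; split=> t; first by case.
by move=> tk; split=> //=; rewrite in_itv/=; exact: ST.
Qed.

Let has_inf_E : has_inf E.
Proof. by split; [exact: E0|exists (Defs.rel j) => t /E_ge]. Qed.

Lemma completion_ge_rel : Defs.rel j <= completion S k (ptime j).
Proof. by apply: lb_le_inf; [exact: E0|move=> t /E_ge]. Qed.

(** The infimum is attained: dates of full work come arbitrarily close to it, and the Lipschitz
    bound carries the amount back to it. *)
Lemma work_completion : work S k (completion S k (ptime j)) = ptime j.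
Proof.
apply/eqP; rewrite eq_le work_le_ptime/=; apply/ler_addgt0Pr => e e0.
have [t Et te] := inf_adherent e0 has_inf_E.
have tC : completion S k (ptime j) <= t := ge_inf has_inf_E.2 Et.
have := work_lipschitz mS k tC; rewrite ((EP t).1 Et).
by move: te; rewrite /completion -/E; lra.
Qed.

Lemma completion_leP t :
  reflect (work S k t = ptime j) (completion S k (ptime j) <= t).
Proof.
apply: (iffP idP) => [Ct|/EP Et]; last exact: (ge_inf has_inf_E.2 Et).
apply/eqP; rewrite eq_le work_le_ptime/= -{1}work_completion.
exact: work_le.
Qed.

End OneJob.
End Feasible.

(** * Lower and upper bounds on costs *)

(* Weighted completion time of Smith's rule from time [t] on for jobs given by
   their (weight, remaining time) pairs: each two jobs are charged the cheaper of
   their two orders. *)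
Fixpoint smith_bound (R : numDomainType) (t : R) (l : seq (R * R)) : R :=
  if l is x :: l' then
    x.1 * (t + x.2) + \sum_(y <- l') Num.min (x.1 * y.2) (y.1 * x.2)
    + smith_bound t l'
  else 0.

Section JobLists.
Variable R : realType.
Implicit Types (S : schedule R) (js : seq (job R)) (U o : seq nat).
Local Notation mu := (@lebesgue_measure R).

Definition inst_of js : inst R := map Some js.

Definition nthjob js k : job R := nth (Job 0 1 0) js k.

(** A recursive conjunction, so that on concrete lists it computes to inequalities for [lra]. *)
Fixpoint all_valid js : Prop :=
  if js is j :: js' then valid_job j /\ all_valid js' else True.

Lemma job_at_inst_of js k :
  job_at (inst_of js) k = if (k < size js)%N then Some (nthjob js k) else None.
Proof.
rewrite /job_at /inst_of; case: ltnP => kn; first by rewrite (nth_map (Job 0 1 0)).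
by rewrite nth_default// size_map.
Qed.

Lemma all_valid_nthjob js k : all_valid js -> (k < size js)%N ->
  valid_job (nthjob js k).
Proof.
by elim: js k => // j js IH [|k] [vj vjs] //= kn; exact: IH.
Qed.

Lemma valid_inst_of js : all_valid js -> valid_inst (inst_of js).
Proof.
move=> vjs k j; rewrite job_at_inst_of; case: ltnP => // kn [<-].
exact: all_valid_nthjob.
Qed.

Definition compl js S k := completion S k (ptime (nthjob js k)).

Lemma cost_inst_of js S :
  cost (inst_of js) S = \sum_(k < size js) wt (nthjob js k) * compl js S k.
Proof.
rewrite /cost [in LHS]/inst_of size_map; apply: eq_bigr => k _.
by rewrite job_at_inst_of ltn_ord.
Qed.

(** A job completes only after the remaining times of all jobs that finish no later than it.
    Splitting this delay into pairs, the later job of each pair pays for the other, which is one of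
    their two orders. *)
Lemma smith_bound_le t (w r C : nat -> R) U :
  uniq U -> (forall k, k \in U -> 0 <= w k) -> (forall k, k \in U -> 0 <= r k) ->
  (forall j, j \in U -> t + \sum_(i <- U | C i <= C j) r i <= C j) ->
  smith_bound t [seq (w k, r k) | k <- U] <= \sum_(k <- U) w k * C k.
Proof.
move=> uU w0 r0 HC.
have step : \sum_(k <- U) w k * (t + \sum_(i <- U | C i <= C k) r i) <=
            \sum_(k <- U) w k * C k.
  rewrite big_seq [leRHS]big_seq; apply: ler_sum => k kU.
  by rewrite ler_wpM2l ?w0 ?HC.
apply: le_trans step => {HC}.
elim: U uU w0 r0 => [|k U IH] /=; first by rewrite big_nil.
move=> /andP[kU uU] w0 r0; rewrite big_cons big_cons lexx.
have {}IH := IH uU (fun j jU => w0 j (@mem_behead _ (k :: U) j jU))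
  (fun j jU => r0 j (@mem_behead _ (k :: U) j jU)).
(* The new label [k] delays exactly those [j] that finish no earlier than it. *)
have -> : \sum_(j <- U) w j * (t + \sum_(i <- k :: U | C i <= C j) r i) =
  \sum_(j <- U) (if C k <= C j then w j * r k else 0) +
  \sum_(j <- U) w j * (t + \sum_(i <- U | C i <= C j) r i).
  rewrite -big_split/=; apply: eq_bigr => j _; rewrite big_cons.
  by case: ifP => _; lra.
suff H : \sum_(y <- [seq (w j, r j) | j <- U]) Num.min (w k * y.2) (y.1 * r k) <=
    w k * \sum_(i <- U | C i <= C k) r i +
    \sum_(j <- U) (if C k <= C j then w j * r k else 0) by lra.
rewrite big_map/= [X in w k * X]big_mkcond mulr_sumr -big_split/= big_seq [leRHS]big_seq.
apply: ler_sum => j jU.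
have [wk rk] : 0 <= w k /\ 0 <= r k by rewrite w0 ?r0 ?mem_head.
have [wj rj] : 0 <= w j /\ 0 <= r j by rewrite w0 ?r0 ?inE ?jU ?orbT.
have wkrj : 0 <= w k * r j by exact: mulr_ge0.
have wjrk : 0 <= w j * r k by exact: mulr_ge0.
rewrite ge_min; apply/orP.
have [jk|/ltW kj] := leP (C j) (C k); first by left; case: ifP; lra.
by right; rewrite kj; lra.
Qed.

Section FeasibleList.
Variables (js : seq (job R)) (S : schedule R).
Hypotheses (vjs : all_valid js) (feasS : feasible (inst_of js) S).

Let mS : measurable_schedule S := feasible_measurable feasS.

Let jobk k : (k < size js)%N -> job_at (inst_of js) k = Some (nthjob js k).
Proof. by move=> kn; rewrite job_at_inst_of kn. Qed.

Let pk k : (k < size js)%N -> 0 < ptime (nthjob js k).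
Proof. by move=> /(all_valid_nthjob vjs) [_ []]. Qed.

Lemma work_list_le k t : (k < size js)%N -> work S k t <= ptime (nthjob js k).
Proof. by move=> /jobk/(work_le_ptime feasS); exact. Qed.

Lemma work_list0 k t : (k < size js)%N -> t <= Defs.rel (nthjob js k) ->
  work S k t = 0.
Proof. by move=> /jobk/(work_before_release feasS); exact. Qed.

Lemma compl_leP k t : (k < size js)%N ->
  reflect (work S k t = ptime (nthjob js k)) (compl js S k <= t).
Proof. by move=> kn; apply: (completion_leP feasS (jobk kn)); exact: pk. Qed.

Lemma compl_ge0 k : (k < size js)%N -> 0 <= compl js S k.
Proof.
move=> kn; have [r0 _] := all_valid_nthjob vjs kn.
exact: le_trans r0 (completion_ge_rel feasS (jobk kn) (pk kn)).
Qed.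

Lemma cost_list_ge0 : 0 <= cost (inst_of js) S.
Proof.
rewrite cost_inst_of; apply: sumr_ge0 => k _; apply: mulr_ge0.
  by have [_ []] := all_valid_nthjob vjs (ltn_ord k).
exact: compl_ge0.
Qed.

(** Between [t] and the completion of [j], the machine must do all the remaining work of the jobs
    that finish no later than [j]. *)
Lemma smith_bound_compl t U : uniq U -> all (fun k => k < size js)%N U ->
  (forall k, k \in U -> t <= compl js S k) ->
  smith_bound t [seq (wt (nthjob js k), ptime (nthjob js k) - work S k t) | k <- U]
    <= \sum_(k <- U) wt (nthjob js k) * compl js S k.
Proof.
move=> uU /allP Un tC; apply: smith_bound_le => // [k /Un kn|k /Un kn|j jU].
- by have [_ []] := all_valid_nthjob vjs kn.
- by rewrite subr_ge0 work_list_le.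
rewrite -lerBrDl -big_filter.
apply: le_trans (sum_work_le mS (filter_uniq _ uU) (tC _ jU)).
rewrite big_seq [leRHS]big_seq; apply: ler_sum => i.
rewrite mem_filter => /andP[ij iU].
by rewrite lerD2r; move/(compl_leP _ (Un _ iU)): ij => ->.
Qed.

End FeasibleList.

Lemma OPT_ge0 js : all_valid js -> 0 <= OPT (inst_of js).
Proof.
move=> vjs; rewrite /OPT.
set X := [set _ | _].
(* Without feasible schedules, [OPT] would be the infimum of the empty set, which is 0 by
   convention. *)
have [->|/set0P X0] := eqVneq X set0; first by rewrite inf0.
by apply: lb_le_inf => // _ [S [fS ->]]; exact: cost_list_ge0.
Qed.

Lemma OPT_le_cost js S : all_valid js -> feasible (inst_of js) S ->
  OPT (inst_of js) <= cost (inst_of js) S.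
Proof.
move=> vjs fS; apply: ge_inf; last by exists S.
by exists 0 => _ [S' [fS' ->]]; exact: cost_list_ge0.
Qed.

End JobLists.

(** * Schedules without preemption or idle time, as upper bounds on the optimum *)

Section Sequential.
Variables (R : realType) (js : seq (job R)).
Implicit Types (o : seq nat) (t : R).
Local Notation mu := (@lebesgue_measure R).
Local Notation p k := (ptime (nthjob js k)).

(** Slots are half-open, so that consecutive jobs do not meet at their common endpoint. *)
Fixpoint seqsched t0 o : schedule R := fun t =>
  if o is k :: o' then
    if t0 <= t < t0 + p k then Some k else seqsched (t0 + p k) o' t
  else None.

Fixpoint start_time t0 o k : R :=
  if o is i :: o' then if i == k then t0 else start_time (t0 + p i) o' k else t0.

Fixpoint seq_released t0 o : Prop :=
  if o is k :: o' then
    Defs.rel (nthjob js k) <= t0 /\ seq_released (t0 + p k) o'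
  else True.

Fixpoint seq_cost t0 o : R :=
  if o is k :: o' then
    wt (nthjob js k) * (t0 + p k) + seq_cost (t0 + p k) o'
  else 0.

Lemma start_time_released t0 o k : seq_released t0 o -> k \in o ->
  Defs.rel (nthjob js k) <= start_time t0 o k.
Proof.
elim: o t0 => //= i o IH t0 [it0 ro]; rewrite inE eq_sym.
by have [<-|_] := eqVneq i k; last exact: IH.
Qed.

Lemma seq_costE t0 o : uniq o ->
  \sum_(k <- o) wt (nthjob js k) * (start_time t0 o k + p k) = seq_cost t0 o.
Proof.
elim: o t0 => [|i o IH] t0 /=; first by rewrite big_nil.
move=> /andP[io uo]; rewrite big_cons eqxx -IH//; congr (_ + _).
apply: eq_big_seq => k ko; case: eqVneq => // ik.
by move: io; rewrite ik ko.
Qed.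

Lemma seqsched_Some t0 o t k : (forall i, i \in o -> 0 <= p i) ->
  seqsched t0 o t = Some k -> k \in o /\ t0 <= t.
Proof.
elim: o t0 => //= i o IH t0 p0; case: ifPn => [/andP[t0t _] [<-]|_].
  by rewrite mem_head.
move=> /IH[j jo|ko tt]; first by apply: p0; rewrite inE jo orbT.
by rewrite inE ko orbT; split=> //; apply: le_trans tt; rewrite lerDl p0// mem_head.
Qed.

Lemma proc_seqsched t0 o k : uniq o -> (forall i, i \in o -> 0 <= p i) ->
  k \in o -> proc_set (seqsched t0 o) k =
             `[start_time t0 o k, start_time t0 o k + p k[%classic.
Proof.
elim: o t0 => //= i o IH t0 /andP[io uo] p0; rewrite inE eq_sym.
have p0' j : j \in o -> 0 <= p j by move=> jo; apply: p0; rewrite inE jo orbT.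
have [<- _|ik /= ko] := eqVneq i k.
  apply/seteqP; split=> t; rewrite /proc_set/= in_itv/=; last by move=> ->.
  by case: ifP => // _ /(seqsched_Some p0')[]; rewrite (negbTE io).
rewrite -IH//; apply/seteqP; split=> t; rewrite /proc_set/=.
  by case: ifP => // _ [/eqP]; rewrite (negbTE ik).
case: ifP => // /andP[_ tp] /(seqsched_Some p0')[_].
by rewrite leNgt tp.
Qed.

Lemma OPT_le_seq o : all_valid js -> perm_eq o (iota 0 (size js)) ->
  seq_released 0 o -> OPT (inst_of js) <= seq_cost 0 o.
Proof.
move=> vjs po ro.
have uo : uniq o by rewrite (perm_uniq po) iota_uniq.
have oE k : (k \in o) = (k < size js)%N by rewrite (perm_mem po) mem_iota.
have p0 i : i \in o -> 0 < p i.
  by rewrite oE => /(all_valid_nthjob vjs) [_ []].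
have p0' i : i \in o -> 0 <= p i by move=> /p0/ltW.
have lam k : k \in o -> mu (proc_set (seqsched 0 o) k) = (p k)%:E.
  move=> ko; rewrite proc_seqsched// lebesgue_measure_itv/= lte_fin.
  by rewrite ltrDl p0// -EFinD addrAC subrr add0r.
have fS : feasible (inst_of js) (seqsched 0 o).
  split=> [t k Sk|k j].
    have [ko _] := seqsched_Some p0' Sk.
    exists (nthjob js k); rewrite job_at_inst_of -oE ko; split=> //.
    apply: le_trans (start_time_released ro ko) _.
    have : proc_set (seqsched 0 o) k t by [].
    by rewrite proc_seqsched//= in_itv/= => /andP[].
  rewrite job_at_inst_of -oE; case: ifP => // ko [<-].
  split; first by rewrite proc_seqsched//; exact: measurable_itv.
  split; first exact: lam.
  exists (start_time 0 o k + p k) => t Sk.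
  have : proc_set (seqsched 0 o) k t by [].
  by rewrite proc_seqsched//= in_itv/= => /andP[_ /ltW].
apply: le_trans (OPT_le_cost vjs fS) _.
rewrite cost_inst_of -seq_costE// (perm_big _ po)/= -[X in iota 0 X]subn0 big_mkord.
apply: ler_sum => k _; have kn := ltn_ord k.
have ko : nat_of_ord k \in o by rewrite oE.
have [_ [_ w0]] := all_valid_nthjob vjs kn.
(* An upper bound on the completion time suffices: all processing of [k] lies in its slot, so [k] is
   complete when the slot ends. *)
rewrite ler_wpM2l//; apply/(compl_leP vjs fS _ kn).
apply: EFin_inj; rewrite -workE; last exact: feasible_measurable fS.
rewrite -lam//; congr (mu _); apply/seteqP; split=> t; first by case.
move=> tk; split=> //=; move: tk; rewrite proc_seqsched//= !in_itv/=.
by move=> /andP[_ /ltW].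
Qed.

End Sequential.

(** * Online algorithms facing an instance that grows *)

Section Online.
Variables (R : realType) (A : inst R -> schedule R).
Hypothesis onA : online_algorithm A.
Implicit Types js ext : seq (job R).

Lemma online_feasible js : all_valid js -> feasible (inst_of js) (A (inst_of js)).
Proof. by move=> /valid_inst_of; exact: onA.2. Qed.

Lemma all_valid_cat js ext : all_valid (js ++ ext) <-> all_valid js /\ all_valid ext.
Proof. by elim: js => [|j js IH] /=; [split=> // -[]|rewrite IH; tauto]. Qed.

Lemma online_work_cat js ext (tau t : R) k : all_valid (js ++ ext) ->
  (forall i, (i < size ext)%N -> tau <= Defs.rel (nthjob ext i)) -> t <= tau ->
  work (A (inst_of (js ++ ext))) k t = work (A (inst_of js)) k t.
Proof.
move=> vje rext ttau; have [vj ve] := (all_valid_cat js ext).1 vje.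
have vI := valid_inst_of vj; have vI' := valid_inst_of vje.
apply: work_ext.
- exact: feasible_measurable (onA.2 _ vI').
- exact: feasible_measurable (onA.2 _ vI).
(* The online condition compares the jobs released up to and including its date. The midpoint lies
   after [s] and before [tau], so no job of [ext] counts. *)
move=> s st; apply: (onA.1 _ _ ((s + t) / 2)) => //; last by lra.
move=> i; rewrite !job_at_inst_of size_cat /nthjob nth_cat.
have [isz|isz] := ltnP i (size js); first by rewrite (leq_trans isz) ?leq_addr.
case: ltnP => //= isz'; case: ifP => //.
have /rext : (i - size js < size ext)%N by rewrite ltn_subLR.
by rewrite /nthjob => ? ?; exfalso; lra.
Qed.

Lemma beats_OPT (c rho U : R) js : 0 < rho -> c < rho -> all_valid js ->
  OPT (inst_of js) <= U -> 0 < U ->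
  rho * U <= cost (inst_of js) (A (inst_of js)) ->
  exists I : inst R, valid_inst I /\ c * OPT I < cost I (A I).
Proof.
move=> rho0 crho vjs OU U0 Uc.
exists (inst_of js); split; first exact: valid_inst_of.
apply: lt_le_trans Uc.
(* If [OPT] is 0, strictness comes from [0 < rho * U]. *)
have := OPT_ge0 vjs; rewrite le_eqVlt => /predU1P[<-|O0].
  by rewrite mulr0 mulr_gt0.
by apply: lt_le_trans (_ : rho * OPT (inst_of js) <= _); rewrite ?ltr_pM2r ?ler_pM2l.
Qed.

End Online.

Section Progress.
Variables (R : realType) (A : inst R -> schedule R).
Hypothesis onA : online_algorithm A.
Implicit Types (js : seq (job R)) (D U o : seq nat) (t s : R).

Definition progress js k t := work (A (inst_of js)) k t.

Lemma online_measurable js : all_valid js -> measurable_schedule (A (inst_of js)).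
Proof. by move=> /(online_feasible onA)/feasible_measurable. Qed.

Lemma progress_ge0 js k t : 0 <= progress js k t.
Proof. exact: work_ge0. Qed.

Lemma progress_le js k s t : all_valid js -> s <= t ->
  progress js k s <= progress js k t.
Proof. by move=> vjs; exact: (work_le (online_measurable vjs)). Qed.

Lemma progress_le_ptime js k t : all_valid js -> (k < size js)%N ->
  progress js k t <= ptime (nthjob js k).
Proof. by move=> vjs; exact: (work_list_le (online_feasible onA vjs)). Qed.

Lemma progress0 js k t : all_valid js -> (k < size js)%N ->
  t <= Defs.rel (nthjob js k) -> progress js k t = 0.
Proof. by move=> vjs; exact: (work_list0 (online_feasible onA vjs)). Qed.

Lemma sum_progress_le js U s t : all_valid js -> uniq U -> s <= t ->
  \sum_(k <- U) progress js k t <= \sum_(k <- U) progress js k s + (t - s).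
Proof.
move=> vjs uU st; rewrite -lerBlDl -sumrB.
exact: (sum_work_le (online_measurable vjs)).
Qed.

Definition smith_from js t U :=
  [seq (wt (nthjob js k), ptime (nthjob js k) - progress js k t) | k <- U].

(** Each member of [gs] pairs a date with jobs still unfinished then. The groups partition the jobs,
    so their Smith bounds add up; delays between groups are dropped. A job that is complete at the
    last date can thus be charged from an earlier one. *)
Lemma smith_beats_OPT (c rho X : R) js o (gs : seq (R * seq nat)) :
  0 < rho -> c < rho -> all_valid js ->
  perm_eq o (iota 0 (size js)) -> seq_released js 0 o ->
  seq_cost js 0 o = X -> 0 < X ->
  perm_eq (flatten (map snd gs)) (iota 0 (size js)) ->
  all (fun g => all (fun k => progress js k g.1 < ptime (nthjob js k)) g.2) gs ->
  rho * X <= \sum_(g <- gs) smith_bound g.1 (smith_from js g.1 g.2) ->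
  exists I : inst R, valid_inst I /\ c * OPT I < cost I (A I).
Proof.
move=> rho0 crho vjs po ro costX X0 pgs /allP unf le_smith.
have OX : OPT (inst_of js) <= X by rewrite -costX; exact: OPT_le_seq.
apply: (beats_OPT rho0 crho vjs OX X0); apply: le_trans le_smith _.
have fS := online_feasible onA vjs.
have ugs : uniq (flatten (map snd gs)) by rewrite (perm_uniq pgs) iota_uniq.
have mem_gs g k : g \in gs -> k \in g.2 -> (k < size js)%N.
  move=> ggs kg; have := perm_mem pgs k; rewrite mem_iota/= => <-.
  by apply/flattenP; exists g.2 => //; exact: map_f.
rewrite cost_inst_of -(big_mkord xpredT (fun k => wt (nthjob js k) * compl js _ k)).
rewrite /index_iota subn0 -(perm_big _ pgs)/= big_flatten/= big_map.
rewrite big_seq [leRHS]big_seq; apply: ler_sum => g ggs.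
apply: smith_bound_compl => //.
- elim: gs ggs ugs {pgs unf mem_gs} => //= h gs IH; rewrite inE cat_uniq.
  by move=> /predU1P[->|/IH{}IH] /and3P[// _ _ /IH].
- by apply/allP => k; exact: mem_gs.
move=> k kg; have kn := mem_gs _ _ ggs kg; have /allP/(_ _ kg) := unf _ ggs.
rewrite leNgt => ltp; apply/negP => /ltW/(compl_leP vjs fS _ kn) wk.
by move: ltp; rewrite /progress wk ltxx.
Qed.

(** Up to [t] the algorithm cannot know of the last job, so all progress is read off on [js], and
    the adversary may let [q] and [v] depend on it. The last job joins the group of date [t] with
    its full size. *)
Lemma smith_beats_OPT_rcons (c rho X : R) js (t q v : R) o
    (gs : seq (R * seq nat)) U :
  0 < rho -> c < rho -> all_valid js -> 0 <= t -> 0 < q -> 0 <= v ->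
  perm_eq o (iota 0 (size js).+1) -> seq_released (rcons js (Job t q v)) 0 o ->
  seq_cost (rcons js (Job t q v)) 0 o = X -> 0 < X ->
  perm_eq (flatten (map snd gs) ++ U) (iota 0 (size js)) ->
  all (fun g => g.1 <= t) gs ->
  all (fun g => all (fun k => progress js k g.1 < ptime (nthjob js k)) g.2) gs ->
  all (fun k => progress js k t < ptime (nthjob js k)) U ->
  rho * X <= \sum_(g <- gs) smith_bound g.1 (smith_from js g.1 g.2) +
             smith_bound t (rcons (smith_from js t U) (v, q)) ->
  exists I : inst R, valid_inst I /\ c * OPT I < cost I (A I).
Proof.
move=> rho0 crho vjs t0 q0 v0 po ro costX X0 pgU /allP gs_le_t /allP ugs unfU.
move=> le_smith; set js' := rcons js _ in ro costX.
have vjs' : all_valid js' by rewrite /js' -cats1; apply/all_valid_cat.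
have szjs' : size js' = (size js).+1 by rewrite size_rcons.
have mem_gs g k : g \in gs -> k \in g.2 -> (k < size js)%N.
  move=> ggs kg; have := perm_mem pgU k; rewrite mem_iota/= => <-.
  by rewrite mem_cat; apply/orP; left; apply/flattenP; exists g.2 => //; exact: map_f.
have memU k : k \in U -> (k < size js)%N.
  by move=> kU; have := perm_mem pgU k; rewrite mem_cat kU orbT mem_iota.
have old k : (k < size js)%N -> nthjob js' k = nthjob js k.
  by move=> kn; rewrite /nthjob nth_rcons kn.
have new : nthjob js' (size js) = Job t q v by rewrite /nthjob nth_rcons ltnn eqxx.
have pold k s : s <= t -> progress js' k s = progress js k s.
  rewrite /progress /js' -cats1 => st.
  by apply: (online_work_cat onA (tau := t)); rewrite ?cats1// => -[].
have pnew : progress js' (size js) t = 0.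
  by apply: progress0; rewrite ?szjs' ?new.
apply: (@smith_beats_OPT c rho X js' o (rcons gs (t, rcons U (size js)))) => //.
- by rewrite szjs'.
- rewrite szjs' -addn1 iotaD add0n/= map_rcons flatten_rcons/= -cats1 catA.
  by rewrite perm_cat2r.
- rewrite all_rcons; apply/andP; split.
    rewrite all_rcons new pnew q0/=; apply/allP => k kinU.
    by rewrite old ?pold ?memU//; exact: (allP unfU).
  apply/allP => g ggs; apply/allP => k kg.
  by rewrite old ?pold ?gs_le_t ?(mem_gs g)//; exact: (allP (ugs _ ggs)).
- apply: le_trans le_smith _; rewrite -[rcons gs _]cats1 big_cat/= big_seq1.
  rewrite big_seq [X in _ <= X + _]big_seq lerD//.
    apply: ler_sum => g ggs; rewrite le_eqVlt; apply/orP; left; apply/eqP.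
    congr smith_bound; apply/eq_in_map => k kg.
    by rewrite old ?pold ?gs_le_t ?(mem_gs g).
  rewrite le_eqVlt; apply/orP; left; apply/eqP; congr smith_bound.
  rewrite /smith_from map_rcons new pnew subr0; congr rcons.
  by apply/eq_in_map => k /memU kn; rewrite old ?pold.
Qed.

End Progress.

(** * Numerical inequalities *)

(** A minimum is eliminated exactly where linear arithmetic settles which order is cheaper; the
    chords of [min_ge] serve where neither order is cheaper throughout. *)
Ltac minl := match goal with |- context [Num.min ?a ?b] =>
  let h := fresh in
  have h : Num.min a b = a by [apply/min_idPl; lra]; rewrite {}h end.

Ltac minr := match goal with |- context [Num.min ?a ?b] =>
  let h := fresh in
  have h : Num.min a b = b by [apply/min_idPr; lra]; rewrite {}h end.

(* The linear bounds [e] given to [min_ge] are rounded chords: where [a - b]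
   ranges over [[-m, M]], both [a] and [b] are at least
   [(m a + M b - m M) / (m + M)]. *)
Tactic Notation "min_ge" uconstr(e) :=
  match goal with |- context [Num.min ?a ?b] =>
    have : e <= Num.min a b by [rewrite le_min; apply/andP; split; lra];
    move: (Num.min a b) => ? ?
  end.

(* In the branch names, A and B stand for the pair released at time 38 or at time
   100, 1 and 2 for the first and second date at which the adversary may release
   its last job, and the digits after the underscore are the labels of the jobs
   completed by that date (other than job 0 in branch B). The left-hand sides are
   the costs of offline schedules; [r k] is the time job [k] still needs at that
   date and [s k] the time it needed when the pair was released. *)
Section Inequalities.
Variable R : realFieldType.

(** The bounds are sizes minus capacity: 57 = 76 - 19, 76 = 111 - 35 for the new pair, 98 = 149 -
    (16 + 35) with job 0 added, 176 = 249 - 73 for all four jobs. *)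
Lemma smith_A1 (r0 r1 r2 r3 : R) :
  0 <= r0 <= 38 -> 0 <= r1 <= 100 -> 0 <= r2 <= 57 -> 0 <= r3 <= 35 ->
  76 <= r2 + r3 -> 98 <= r0 + r2 + r3 -> 176 <= r0 + r1 + r2 + r3 ->
  883%:R / 800%:R *
    (37 * 38 + 61 * 73 + 226 * (73 + 67) + 136 * (149 + 67) + 100 * (249 + 67)) <=
    smith_bound 73 [:: (37, r0); (100, r1); (136, r2); (61, r3); (226, 67)].
Proof.
move=> *; rewrite /= !(big_cons, big_nil) /=.
(* Each split compares the densities of two jobs, here job 0 and the last job, and resolves the
   minimum belonging to that pair. *)
have [h3|h3] := leP (37 * 67) (226 * r0).
  have [h0|h0] := leP (37 * r1) (100 * r0).
    have [h5|h5] := leP (100 * r3) (61 * r1).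
      by do 4 minl; min_ge (44 * r2 + 39 * r3 - 668); do 2 minl; lra.
    by do 4 minl; minr; do 2 minl; lra.
  by min_ge (20 * r0 + 31 * r2 - 495); min_ge (18 * r0 + 26 * r3 - 457);
     do 3 minl; min_ge (44 * r2 + 39 * r3 - 668); do 2 minl; lra.
by do 3 minr; do 3 minl; minr; do 2 minl; lra.
Qed.

(** Here 16 = 76 - 60, 35 = 111 - 76, 57 = 149 - (16 + 76) and 135 = 249 - 114. *)
Lemma smith_A2 (r0 r1 r2 r3 : R) :
  0 <= r0 <= 38 -> 0 <= r1 <= 100 -> 16 <= r2 <= 76 -> 0 <= r3 <= 35 ->
  35 <= r2 + r3 -> 57 <= r0 + r2 + r3 -> 135 <= r0 + r1 + r2 + r3 ->
  883%:R / 800%:R * (37 * 38 + 136 * 114 + 61 * 149 + 100 * 249) <=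
    smith_bound 114 [:: (37, r0); (100, r1); (136, r2); (61, r3)].
Proof.
move=> *; rewrite /= !(big_cons, big_nil) /=.
have [h1|h1] := leP (37 * r2) (136 * r0).
  have [h5|h5] := leP (136 * r3) (61 * r2).
    have [h3|h3] := leP (100 * r2) (136 * r1).
      by min_ge (52 * r0 + 18 * r1 - 1368); do 2 minl; lra.
    by do 2 minl; min_ge (30 * r1 + 50 * r3 - 1705); lra.
  have [h4|h4] := leP (100 * r3) (61 * r1).
    by min_ge (55 * r0 + 16 * r1 - 1405); min_ge (21 * r0 + 24 * r3 - 658);
       minl; lra.
  have [h0|h0] := leP (37 * r1) (100 * r0).
    by min_ge (14 * r0 + 29 * r3 - 379); min_ge (75 * r1 + 45 * r2 - 3424);
       lra.
  by minr; minl; lra.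
have [h3|h3] := leP (100 * r2) (136 * r1).
  by minr; min_ge (31 * r0 + 18 * r3 - 641);
     min_ge (10 * r1 + 83 * r3 - 1037); min_ge (27 * r2 + 76 * r3 - 2072); lra.
by min_ge (52 * r0 + 18 * r1 - 1013); min_ge (31 * r0 + 18 * r3 - 641);
   min_ge (30 * r1 + 51 * r3 - 1682); min_ge (17 * r2 + 99 * r3 - 1292); lra.
Qed.

Lemma smith_A2_0 (s0 r1 r2 r3 : R) :
  22 <= s0 <= 38 -> 0 <= r1 <= 100 -> 16 <= r2 <= 76 -> 0 <= r3 <= 35 ->
  57 <= r2 + r3 -> 135 <= r1 + r2 + r3 ->
  883%:R / 800%:R *
    (37 * 38 + 136 * 114 + 130 * (114 + 20) + 61 * (149 + 20) + 100 * (249 + 20)) <=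
    smith_bound 38 [:: (37, s0)] +
    smith_bound 114 [:: (100, r1); (136, r2); (61, r3); (130, 20)].
Proof.
move=> *; rewrite /= !(big_cons, big_nil) /=.
have [h0|h0] := leP (100 * r2) (136 * r1).
  have [h1|h1] := leP (100 * r3) (61 * r1).
    by minl; min_ge (26 * r2 + 78 * r3 - 1976); minl; min_ge (35 * r3 - 5);
       lra.
  by minl; minr; do 2 minl; lra.
by min_ge (24 * r1 + 60 * r3 - 1217); minl; min_ge (14 * r2 + 105 * r3 - 968);
   minl; min_ge (26 * r3 + 310); lra.
Qed.

Lemma smith_A2_1 (s1 r0 r2 r3 : R) :
  62 <= s1 <= 100 -> 0 <= r0 <= 38 -> 16 <= r2 <= 76 -> 0 <= r3 <= 35 ->
  35 <= r2 + r3 -> 135 <= r0 + r2 + r3 ->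
  883%:R / 800%:R *
    (37 * 38 + 136 * 114 + 90 * (114 + 33) + 61 * (149 + 33) + 100 * (249 + 33)) <=
    smith_bound 38 [:: (100, s1)] +
    smith_bound 114 [:: (37, r0); (136, r2); (61, r3); (90, 33)].
Proof.
move=> *; rewrite /= !(big_cons, big_nil) /=.
by do 3 minl; min_ge (22 * r2 + 88 * r3 - 664); minl; min_ge (9 * r3 + 1698);
   lra.
Qed.

Lemma smith_A2_3 (r0 r1 r2 : R) :
  0 <= r0 <= 38 -> 0 <= r1 <= 100 -> 35 <= r2 <= 76 -> 57 <= r0 + r2 ->
  135 <= r0 + r1 + r2 ->
  883%:R / 800%:R *
    (37 * 38 + 136 * 114 + 160 * (114 + 40) + 61 * (149 + 40) + 100 * (249 + 40)) <=
    smith_bound 38 [:: (61, 35)] +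
    smith_bound 114 [:: (37, r0); (100, r1); (136, r2); (160, 40)].
Proof.
move=> *; rewrite /= !(big_cons, big_nil) /=.
have [h2|h2] := leP (37 * 40) (160 * r0).
  have [h3|h3] := leP (100 * r2) (136 * r1).
    have [h0|h0] := leP (37 * r1) (100 * r0).
      by do 3 minl; lra.
    by min_ge (40 * r0 + 26 * r2 - 1095); do 2 minl; lra.
  by min_ge (27 * r0 + 27 * r1 - 834); min_ge (45 * r0 + 25 * r2 - 1059);
     min_ge (18 * r1 + 2982); minl; lra.
by do 2 minr; min_ge (12 * r1 + 91 * r2 - 771); do 2 minl; lra.
Qed.

Lemma smith_A2_03 (s0 r1 r2 : R) :
  22 <= s0 <= 38 -> 0 <= r1 <= 100 -> 57 <= r2 <= 76 -> 135 <= r1 + r2 ->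
  883%:R / 800%:R *
    (37 * 38 + 136 * 114 + 100 * (114 + 40) + 61 * (149 + 40) + 100 * (249 + 40)) <=
    smith_bound 38 [:: (37, s0); (61, 35)] +
    smith_bound 114 [:: (100, r1); (136, r2); (100, 40)].
Proof.
move=> *; rewrite /= !(big_cons, big_nil) /=.
by do 4 minl; lra.
Qed.

(** Here 65 = 75 - 10, 75 = 97 - 22 and 113 = 197 - (62 + 22). Job 0 is complete and charged its
    full size from date 0. *)
Lemma smith_B1 (r1 r2 r3 : R) :
  0 <= r1 <= 100 -> 0 <= r2 <= 65 -> 0 <= r3 <= 22 -> 75 <= r2 + r3 ->
  113 <= r1 + r2 + r3 ->
  883%:R / 800%:R *
    (100 * 100 + 52 * 122 + 180 * (122 + 49) + 193 * (197 + 49) + 37 * (235 + 49)) <=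
    smith_bound 0 [:: (37, 38)] +
    smith_bound 122 [:: (100, r1); (193, r2); (52, r3); (180, 49)].
Proof.
move=> *; rewrite /= !(big_cons, big_nil) /=.
have [h0|h0] := leP (100 * r2) (193 * r1).
  by min_ge (6 * r1 + 88 * r3 - 508); minl; min_ge (26 * r2 + 95 * r3 - 712);
     minl; min_ge (62 * r3 + 1180); lra.
by min_ge (38 * r1 + 27 * r3 - 235); min_ge (29 * r1 + 3923);
   min_ge (34 * r2 + 68 * r3 - 420); do 2 minl; lra.
Qed.

Lemma smith_B2 (r1 r2 r3 : R) :
  0 <= r1 <= 100 -> 12 <= r2 <= 75 -> 0 <= r3 <= 22 -> 22 <= r2 + r3 ->
  60 <= r1 + r2 + r3 ->
  883%:R / 800%:R * (100 * 100 + 193 * 175 + 52 * 197 + 37 * 235) <=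
    smith_bound 0 [:: (37, 38)] +
    smith_bound 175 [:: (100, r1); (193, r2); (52, r3)].
Proof.
move=> *; rewrite /= !(big_cons, big_nil) /=.
have [h2|h2] := leP (193 * r3) (52 * r2).
  have [h1|h1] := leP (100 * r3) (52 * r1).
    have [h0|h0] := leP (100 * r2) (193 * r1).
      by lra.
    by lra.
  by minr; lra.
have [h0|h0] := leP (100 * r2) (193 * r1).
  by min_ge (13 * r1 + 76 * r3 - 1188); lra.
by minr; lra.
Qed.

Lemma smith_B2_1 (s1 r2 r3 : R) :
  38 <= s1 <= 100 -> 12 <= r2 <= 75 -> 0 <= r3 <= 22 -> 60 <= r2 + r3 ->
  883%:R / 800%:R *
    (100 * 100 + 193 * 175 + 133 * (175 + 26) + 52 * (197 + 26) + 37 * (235 + 26)) <=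
    smith_bound 0 [:: (37, 38)] +
    smith_bound 100 [:: (100, s1)] +
    smith_bound 175 [:: (193, r2); (52, r3); (133, 26)].
Proof.
move=> *; rewrite /= !(big_cons, big_nil) /=.
have [h0|h0] := leP (193 * r3) (52 * r2).
  by minl; min_ge (67 * r3 - 2); lra.
by do 2 minl; lra.
Qed.

Lemma smith_B2_3 (r1 r2 : R) :
  0 <= r1 <= 100 -> 22 <= r2 <= 75 -> 60 <= r1 + r2 ->
  883%:R / 800%:R * (100 * 100 + 193 * 175 + 52 * 197 + 37 * 235) <=
    smith_bound 0 [:: (37, 38)] +
    smith_bound 100 [:: (52, 22)] +
    smith_bound 175 [:: (100, r1); (193, r2)].
Proof.
move=> *; rewrite /= !(big_cons, big_nil) /=.
have [h0|h0] := leP (100 * r2) (193 * r1).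
  by lra.
by lra.
Qed.

Lemma smith_B2_13 (s1 r2 : R) :
  38 <= s1 <= 100 -> 60 <= r2 <= 75 ->
  883%:R / 800%:R *
    (100 * 100 + 193 * 175 + 130 * (175 + 40) + 52 * (197 + 40) + 37 * (235 + 40)) <=
    smith_bound 0 [:: (37, 38)] +
    smith_bound 100 [:: (100, s1); (52, 22)] +
    smith_bound 175 [:: (193, r2); (130, 40)].
Proof.
move=> *; rewrite /= !(big_cons, big_nil) /=.
by min_ge (4 * s1 + 1800); minl; lra.
Qed.

(** Job 0 received at least 16 of its 38 units, and 38 = 138 - 100 units of work are left at date
    100. *)
Lemma smith_stop (r0 r1 : R) :
  0 <= r0 <= 22 -> 0 <= r1 <= 100 -> 38 <= r0 + r1 ->
  883%:R / 800%:R * (100 * 100 + 37 * 138) <=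
    smith_bound 100 [:: (37, r0); (100, r1)].
Proof.
move=> *; rewrite /= !(big_cons, big_nil) /=.
by min_ge (70 * r0 + 11 * r1 - 1124); lra.
Qed.

End Inequalities.

(** * Machine capacity turned into bounds on remaining times *)

Section Capacity.
Variable R : realFieldType.

Section BranchA.
Variables (x0 x1 : R).
Hypotheses (hx0 : 0 <= x0 <= 16) (hx1 : 0 <= x1) (hx : x0 + x1 <= 38).

(** The amounts [x], [y] and [z] are those processed by dates 38, 73 and 114. Since job 2 took 19 of
    the 35 units after 38, at most 16 went to the others, too little to complete any. *)
Lemma capacity_A1 y0 y1 y2 y3 :
  x0 <= y0 -> x1 <= y1 -> 19 <= y2 -> 0 <= y3 ->
  y0 + y1 + y2 + y3 <= x0 + x1 + 35 ->
  [&& y0 < 38, y1 < 100, y2 < 76 & y3 < 35] /\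
  883%:R / 800%:R *
    (37 * 38 + 61 * 73 + 226 * (73 + 67) + 136 * (149 + 67) + 100 * (249 + 67)) <=
    smith_bound 73 [:: (37, 38 - y0); (100, 100 - y1); (136, 76 - y2);
                       (61, 35 - y3); (226, 67)].
Proof.
move: hx0 hx1 hx => *; split; first by apply/and4P; split; lra.
by apply: smith_A1; lra.
Qed.

Variables (z0 z1 z2 z3 : R).
Hypotheses (hz0 : x0 <= z0 <= 38) (hz1 : x1 <= z1 <= 100).
Hypotheses (hz2 : 0 <= z2 <= 60) (hz3 : 0 <= z3 <= 35).
Hypothesis hz : z0 + z1 + z2 + z3 <= x0 + x1 + 76.

(** Completing job 1 by 114 leaves 14 units for all other jobs, so none of them is complete. *)
Lemma capacity_A2_1 : z1 = 100 -> [&& z0 < 38, z2 < 76 & z3 < 35] /\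
  883%:R / 800%:R *
    (37 * 38 + 136 * 114 + 90 * (114 + 33) + 61 * (149 + 33) + 100 * (249 + 33)) <=
    smith_bound 38 [:: (100, 100 - x1)] +
    smith_bound 114 [:: (37, 38 - z0); (136, 76 - z2); (61, 35 - z3); (90, 33)].
Proof.
move: hx0 hx1 hx hz0 hz1 hz2 hz3 hz => *; split; first by apply/and3P; split; lra.
by apply: smith_A2_1; lra.
Qed.

Lemma capacity_A2 :
  883%:R / 800%:R * (37 * 38 + 136 * 114 + 61 * 149 + 100 * 249) <=
    smith_bound 114 [:: (37, 38 - z0); (100, 100 - z1); (136, 76 - z2); (61, 35 - z3)].
Proof. by move: hx0 hx1 hx hz0 hz1 hz2 hz3 hz => *; apply: smith_A2; lra. Qed.

Lemma capacity_A2_0 : z0 = 38 ->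
  883%:R / 800%:R *
    (37 * 38 + 136 * 114 + 130 * (114 + 20) + 61 * (149 + 20) + 100 * (249 + 20)) <=
    smith_bound 38 [:: (37, 38 - x0)] +
    smith_bound 114 [:: (100, 100 - z1); (136, 76 - z2); (61, 35 - z3); (130, 20)].
Proof. by move: hx0 hx1 hx hz0 hz1 hz2 hz3 hz => *; apply: smith_A2_0; lra. Qed.

Lemma capacity_A2_3 : z3 = 35 ->
  883%:R / 800%:R *
    (37 * 38 + 136 * 114 + 160 * (114 + 40) + 61 * (149 + 40) + 100 * (249 + 40)) <=
    smith_bound 38 [:: (61, 35)] +
    smith_bound 114 [:: (37, 38 - z0); (100, 100 - z1); (136, 76 - z2); (160, 40)].
Proof. by move: hx0 hx1 hx hz0 hz1 hz2 hz3 hz => *; apply: smith_A2_3; lra. Qed.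

Lemma capacity_A2_03 : z0 = 38 -> z3 = 35 ->
  883%:R / 800%:R *
    (37 * 38 + 136 * 114 + 100 * (114 + 40) + 61 * (149 + 40) + 100 * (249 + 40)) <=
    smith_bound 38 [:: (37, 38 - x0); (61, 35)] +
    smith_bound 114 [:: (100, 100 - z1); (136, 76 - z2); (100, 40)].
Proof. by move: hx0 hx1 hx hz0 hz1 hz2 hz3 hz => *; apply: smith_A2_03; lra. Qed.

End BranchA.

Section BranchB.
Variable x1 : R.
Hypothesis hx1 : 0 <= x1 <= 62.

(** Since job 2 took 10 of the 22 units after 100, at most 12 went to jobs 1 and 3. *)
Lemma capacity_B1 y1 y2 y3 :
  x1 <= y1 -> 10 <= y2 -> 0 <= y3 -> y1 + y2 + y3 <= x1 + 22 ->
  [&& y1 < 100, y2 < 75 & y3 < 22] /\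
  883%:R / 800%:R *
    (100 * 100 + 52 * 122 + 180 * (122 + 49) + 193 * (197 + 49) + 37 * (235 + 49)) <=
    smith_bound 0 [:: (37, 38)] +
    smith_bound 122 [:: (100, 100 - y1); (193, 75 - y2); (52, 22 - y3); (180, 49)].
Proof. by move: hx1 => *; split; [apply/and3P; split; lra|apply: smith_B1; lra]. Qed.

Variables (z1 z2 z3 : R).
Hypotheses (hz1 : x1 <= z1 <= 100) (hz2 : 0 <= z2 <= 63) (hz3 : 0 <= z3 <= 22).
Hypothesis hz : z1 + z2 + z3 <= x1 + 75.

Lemma capacity_B2 :
  883%:R / 800%:R * (100 * 100 + 193 * 175 + 52 * 197 + 37 * 235) <=
    smith_bound 0 [:: (37, 38)] +
    smith_bound 175 [:: (100, 100 - z1); (193, 75 - z2); (52, 22 - z3)].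
Proof. by move: hx1 hz1 hz2 hz3 hz => *; apply: smith_B2; lra. Qed.

Lemma capacity_B2_1 : z1 = 100 ->
  883%:R / 800%:R *
    (100 * 100 + 193 * 175 + 133 * (175 + 26) + 52 * (197 + 26) + 37 * (235 + 26)) <=
    smith_bound 0 [:: (37, 38)] +
    smith_bound 100 [:: (100, 100 - x1)] +
    smith_bound 175 [:: (193, 75 - z2); (52, 22 - z3); (133, 26)].
Proof. by move: hx1 hz1 hz2 hz3 hz => *; apply: smith_B2_1; lra. Qed.

Lemma capacity_B2_3 : z3 = 22 ->
  883%:R / 800%:R * (100 * 100 + 193 * 175 + 52 * 197 + 37 * 235) <=
    smith_bound 0 [:: (37, 38)] +
    smith_bound 100 [:: (52, 22)] +
    smith_bound 175 [:: (100, 100 - z1); (193, 75 - z2)].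
Proof. by move: hx1 hz1 hz2 hz3 hz => *; apply: smith_B2_3; lra. Qed.

(** Jobs 1 and 3 use 122 of the 137 units that job 0 leaves before 175, so job 2 received at most
    15. *)
Lemma capacity_B2_13 : z1 = 100 -> z3 = 22 ->
  883%:R / 800%:R *
    (100 * 100 + 193 * 175 + 130 * (175 + 40) + 52 * (197 + 40) + 37 * (235 + 40)) <=
    smith_bound 0 [:: (37, 38)] +
    smith_bound 100 [:: (100, 100 - x1); (52, 22)] +
    smith_bound 175 [:: (193, 75 - z2); (130, 40)].
Proof. by move: hx1 hz1 hz2 hz3 hz => *; apply: smith_B2_13; lra. Qed.

End BranchB.
End Capacity.

(** * The adversary *)

Section Instances.
Variable R : realType.
Implicit Types q v : R.

(* These sizes and weights were found by numerical optimisation, in units of a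
   hundredth of the long job. *)
Definition jobs0 : seq (job R) := [:: Job 0 38 37; Job 0 100 100].
Definition jobsA : seq (job R) := jobs0 ++ [:: Job 38 76 136; Job 38 35 61].
Definition jobsB : seq (job R) := jobs0 ++ [:: Job 100 75 193; Job 100 22 52].

Lemma valid_jobs0 : all_valid jobs0.
Proof. by rewrite /= /valid_job /=; repeat split; lra. Qed.

Lemma valid_jobsA : all_valid jobsA.
Proof. by rewrite /= /valid_job /=; repeat split; lra. Qed.

Lemma valid_jobsB : all_valid jobsB.
Proof. by rewrite /= /valid_job /=; repeat split; lra. Qed.

Local Notation sched js o X :=
  [/\ seq_released js 0 o, seq_cost js 0 o = X :> R & 0 < X :> R].

Ltac sched_lra := split; rewrite /= /nthjob /=; [repeat split|..]; lra.

Lemma sched_0 : sched jobs0 [:: 1; 0]%N (100 * 100 + 37 * 138).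
Proof. by sched_lra. Qed.

Lemma sched_A :
  sched jobsA [:: 0; 2; 3; 1]%N (37 * 38 + 136 * 114 + 61 * 149 + 100 * 249).
Proof. by sched_lra. Qed.

Lemma sched_B :
  sched jobsB [:: 1; 2; 3; 0]%N (100 * 100 + 193 * 175 + 52 * 197 + 37 * 235).
Proof. by sched_lra. Qed.

(** The dates are chosen so that the optimum has just completed one job of each pair when the last
    job arrives: 73 = 38 + 35 here, then 114 = 38 + 76, 122 = 100 + 22 and 175 = 100 + 75. *)
Lemma sched_A73 q v : 0 < q -> 0 <= v ->
  sched (rcons jobsA (Job 73 q v)) [:: 0; 3; 4; 2; 1]%N
    (37 * 38 + 61 * 73 + v * (73 + q) + 136 * (149 + q) + 100 * (249 + q)).
(* The product [v * q] is not linear, so its sign is supplied to [lra]. *)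
Proof. by move=> q0 v0; have qv := mulr_ge0 v0 (ltW q0); sched_lra. Qed.

Lemma sched_A114 q v : 0 < q -> 0 <= v ->
  sched (rcons jobsA (Job 114 q v)) [:: 0; 2; 4; 3; 1]%N
    (37 * 38 + 136 * 114 + v * (114 + q) + 61 * (149 + q) + 100 * (249 + q)).
Proof. by move=> q0 v0; have qv := mulr_ge0 v0 (ltW q0); sched_lra. Qed.

Lemma sched_B122 q v : 0 < q -> 0 <= v ->
  sched (rcons jobsB (Job 122 q v)) [:: 1; 3; 4; 2; 0]%N
    (100 * 100 + 52 * 122 + v * (122 + q) + 193 * (197 + q) + 37 * (235 + q)).
Proof. by move=> q0 v0; have qv := mulr_ge0 v0 (ltW q0); sched_lra. Qed.

Lemma sched_B175 q v : 0 < q -> 0 <= v ->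
  sched (rcons jobsB (Job 175 q v)) [:: 1; 2; 4; 3; 0]%N
    (100 * 100 + 193 * 175 + v * (175 + q) + 52 * (197 + q) + 37 * (235 + q)).
Proof. by move=> q0 v0; have qv := mulr_ge0 v0 (ltW q0); sched_lra. Qed.

End Instances.

Section Adversary.
Variables (R : realType) (A : inst R -> schedule R).
Hypothesis onA : online_algorithm A.
Variable c : R.
Hypothesis lt_c : c < 883%:R / 800%:R.

Local Notation pr := (progress A).
Local Notation beaten :=
  (exists I : inst R, valid_inst I /\ c * OPT I < cost I (A I)).
Local Notation jobs0 := (jobs0 R).
Local Notation jobsA := (jobsA R).
Local Notation jobsB := (jobsB R).
Local Notation smith_sum js gs :=
  (\sum_(g <- gs) smith_bound g.1 (smith_from A js g.1 g.2)).
Local Notation unfinished js gs :=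
  (all (fun g => all (fun k => pr js k g.1 < ptime (nthjob js k)) g.2) gs).

Let rho_gt0 : 0 < 883%:R / 800%:R :> R. Proof. by lra. Qed.

Lemma beaten_A_stop :
  unfinished jobsA [:: (114, [:: 0; 1; 2; 3]%N)] ->
  883%:R / 800%:R * (37 * 38 + 136 * 114 + 61 * 149 + 100 * 249) <=
    smith_sum jobsA [:: (114, [:: 0; 1; 2; 3]%N)] -> beaten.
Proof.
have [rel cost pos] := sched_A R.
exact: (smith_beats_OPT onA rho_gt0 lt_c (valid_jobsA R) _ rel cost pos).
Qed.

Lemma beaten_A73 (q v : R) : 0 < q -> 0 <= v ->
  all (fun k => pr jobsA k 73 < ptime (nthjob jobsA k)) [:: 0; 1; 2; 3]%N ->
  883%:R / 800%:R *
    (37 * 38 + 61 * 73 + v * (73 + q) + 136 * (149 + q) + 100 * (249 + q)) <=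
    smith_bound 73 (rcons (smith_from A jobsA 73 [:: 0; 1; 2; 3]%N) (v, q)) -> beaten.
Proof.
move=> q0 v0 unf le_smith; have [rel cost pos] := sched_A73 q0 v0.
apply: (smith_beats_OPT_rcons (gs := [::]) onA rho_gt0 lt_c (valid_jobsA R)
  (ler0n _ _) q0 v0 _ rel cost pos _ _ _ unf) => //.
by rewrite big_nil add0r.
Qed.

(** [D] holds the jobs completed by 114; they are charged from 38, where they were unfinished. *)
Lemma beaten_A114 (q v : R) (D U : seq nat) : 0 < q -> 0 <= v ->
  perm_eq (D ++ U) (iota 0 4) ->
  all (fun k => pr jobsA k 38 < ptime (nthjob jobsA k)) D ->
  all (fun k => pr jobsA k 114 < ptime (nthjob jobsA k)) U ->
  883%:R / 800%:R *
    (37 * 38 + 136 * 114 + v * (114 + q) + 61 * (149 + q) + 100 * (249 + q)) <=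
    smith_bound 38 (smith_from A jobsA 38 D) +
    smith_bound 114 (rcons (smith_from A jobsA 114 U) (v, q)) -> beaten.
Proof.
move=> q0 v0 pDU unfD unfU le_smith; have [rel cost pos] := sched_A114 q0 v0.
apply: (smith_beats_OPT_rcons (gs := [:: (38, D)]) onA rho_gt0 lt_c
  (valid_jobsA R) (ler0n _ _) q0 v0 _ rel cost pos _ _ _ unfU) => //.
- by rewrite /= cats0.
- by rewrite /= andbT ler_nat.
- by rewrite /= andbT.
- by rewrite big_seq1.
Qed.

Lemma beaten_A : pr jobs0 0 38 <= 16 -> beaten.
Proof.
have vA := valid_jobsA R; move=> x0.
(* The decision to release the second pair rests on progress that the release does not alter. *)
have p38 k : pr jobsA k 38 = pr jobs0 k 38.
  apply: (online_work_cat onA (tau := 38)) => //.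
  by move=> [|[]] //=; rewrite /nthjob /=; lra.
rewrite -p38 in x0.
have p0 k : (k < 4)%N -> pr jobsA k 0 = 0.
  move=> k4; apply: (progress0 onA) => //.
  by have [] := all_valid_nthjob vA k4.
have [p2 p3] : pr jobsA 2 38 = 0 /\ pr jobsA 3 38 = 0.
  by split; apply: (progress0 onA) => //; rewrite /nthjob /=; lra.
have sumA s t : s <= t -> pr jobsA 0 t + pr jobsA 1 t + pr jobsA 2 t + pr jobsA 3 t <=
    pr jobsA 0 s + pr jobsA 1 s + pr jobsA 2 s + pr jobsA 3 s + (t - s).
  move=> st; have := sum_progress_le onA vA (isT : uniq [:: 0; 1; 2; 3]%N) st.
  by rewrite !(big_cons, big_nil) !addr0 !addrA.
have mono k s t : s <= t -> pr jobsA k s <= pr jobsA k t by exact: progress_le.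
have [le38 [le73 le114]] : 0 <= 38 :> R /\ 38 <= 73 :> R /\ 73 <= 114 :> R.
  by rewrite ler0n !ler_nat.
have hx0 : 0 <= pr jobsA 0 38 <= 16 by rewrite progress_ge0.
have hx1 : 0 <= pr jobsA 1 38 by exact: progress_ge0.
have hx : pr jobsA 0 38 + pr jobsA 1 38 <= 38.
  by have := sumA _ _ le38; rewrite !p0// p2 p3 !addr0 subr0 add0r.
have [ge19|lt19] := leP 19 (pr jobsA 2 73).
  have hy : pr jobsA 0 73 + pr jobsA 1 73 + pr jobsA 2 73 + pr jobsA 3 73 <=
      pr jobsA 0 38 + pr jobsA 1 38 + 35.
    by have := sumA _ _ le73; rewrite p2 p3; lra.
  have [/and4P[u0 u1 u2 u3] le_smith] := capacity_A1 hx0 hx1 hx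
    (mono 0%N _ _ le73) (mono 1%N _ _ le73) ge19 (progress_ge0 A jobsA 3 73) hy.
  apply: (beaten_A73 _ (ler0n _ _) _ le_smith); first by rewrite ltr0n.
  by rewrite /= /nthjob /= u0 u1 u2 u3.
(* 60 = 19 + (114 - 73). *)
have hz2 : 0 <= pr jobsA 2 114 <= 60.
  rewrite progress_ge0/=.
  have := sum_progress_le onA vA (isT : uniq [:: 2]%N) le114.
  by rewrite !big_seq1; move: lt19; lra.
have hz0 : pr jobsA 0 38 <= pr jobsA 0 114 <= 38.
  by rewrite mono ?(le_trans le73 le114)//=; exact: (progress_le_ptime onA).
have hz1 : pr jobsA 1 38 <= pr jobsA 1 114 <= 100.
  by rewrite mono ?(le_trans le73 le114)//=; exact: (progress_le_ptime onA).
have hz3 : 0 <= pr jobsA 3 114 <= 35.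
  by rewrite progress_ge0/=; exact: (progress_le_ptime onA).
have hz : pr jobsA 0 114 + pr jobsA 1 114 + pr jobsA 2 114 + pr jobsA 3 114 <=
    pr jobsA 0 38 + pr jobsA 1 38 + 76.
  by have := sumA _ _ (le_trans le73 le114); rewrite p2 p3; lra.
have u2 : pr jobsA 2 114 < 76 by move: hz2; lra.
have w0 : pr jobsA 0 38 < 38 by move: hx0; lra.
have w1 : pr jobsA 1 38 < 100 by move: hx0 hx; lra.
have w3 : pr jobsA 3 38 < 35 by rewrite p3; lra.
(* Job 2 is unfinished at 114. Which of jobs 1, 0 and 3 are complete decides the last job; if none
   is, the instance ends with [jobsA]. *)
have [z1|z1] := eqVneq (pr jobsA 1 114) 100.
  have [/and3P[u0 _ u3] le_smith] := capacity_A2_1 hx0 hx1 hx hz0 hz1 hz2 hz3 hz z1.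
  apply: (beaten_A114 (D := [:: 1%N]) (U := [:: 0; 2; 3]%N)
    _ (ler0n _ _) _ _ _ le_smith) => //.
  - by rewrite /= /nthjob /= w1.
  - by rewrite /= /nthjob /= u0 u2 u3.
have u1 : pr jobsA 1 114 < 100 by rewrite lt_neqAle z1; case/andP: hz1.
have [z0|z0] := eqVneq (pr jobsA 0 114) 38;
    have [z3|z3] := eqVneq (pr jobsA 3 114) 35.
- apply: (beaten_A114 (q := 40) (v := 100) (D := [:: 0; 3]%N) (U := [:: 1; 2]%N)) => //.
  - by rewrite /= /nthjob /= w0 w3.
  - by rewrite /= /nthjob /= u1 u2.
  have -> : smith_from A jobsA 38 [:: 0; 3]%N = [:: (37, 38 - pr jobsA 0 38); (61, 35)].
    by rewrite /smith_from /= p3 subr0.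
  exact: (capacity_A2_03 hx0 hx1 hx hz0 hz1 hz2 hz3 hz z0 z3).
- have u3 : pr jobsA 3 114 < 35 by rewrite lt_neqAle z3; case/andP: hz3.
  apply: (beaten_A114 (q := 20) (v := 130) (D := [:: 0%N]) (U := [:: 1; 2; 3]%N)) => //.
  - by rewrite /= /nthjob /= w0.
  - by rewrite /= /nthjob /= u1 u2 u3.
  exact: (capacity_A2_0 hx0 hx1 hx hz0 hz1 hz2 hz3 hz z0).
- have u0 : pr jobsA 0 114 < 38 by rewrite lt_neqAle z0; case/andP: hz0.
  apply: (beaten_A114 (q := 40) (v := 160) (D := [:: 3%N]) (U := [:: 0; 1; 2]%N)) => //.
  - by rewrite /= /nthjob /= w3.
  - by rewrite /= /nthjob /= u0 u1 u2.
  have -> : smith_from A jobsA 38 [:: 3]%N = [:: (61, 35)].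
    by rewrite /smith_from /= p3 subr0.
  exact: (capacity_A2_3 hx0 hx1 hx hz0 hz1 hz2 hz3 hz z3).
- have u0 : pr jobsA 0 114 < 38 by rewrite lt_neqAle z0; case/andP: hz0.
  have u3 : pr jobsA 3 114 < 35 by rewrite lt_neqAle z3; case/andP: hz3.
  apply: beaten_A_stop; first by rewrite /= /nthjob /= u0 u1 u2 u3.
  rewrite big_seq1.
  exact: (capacity_A2 hx0 hx1 hx hz0 hz1 hz2 hz3 hz).
Qed.

Lemma beaten_B_stop (D U : seq nat) :
  perm_eq (0%N :: D ++ U) (iota 0 4) ->
  unfinished jobsB [:: (0, [:: 0%N]); (100, D); (175, U)] ->
  883%:R / 800%:R * (100 * 100 + 193 * 175 + 52 * 197 + 37 * 235) <=
    smith_sum jobsB [:: (0, [:: 0%N]); (100, D); (175, U)] -> beaten.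
Proof.
move=> pDU; have [rel cost pos] := sched_B R.
apply: (smith_beats_OPT onA rho_gt0 lt_c (valid_jobsB R) _ rel cost pos) => //.
by rewrite /= cats0.
Qed.

Lemma beaten_B122 (q v : R) : 0 < q -> 0 <= v ->
  unfinished jobsB [:: (0, [:: 0%N])] ->
  all (fun k => pr jobsB k 122 < ptime (nthjob jobsB k)) [:: 1; 2; 3]%N ->
  883%:R / 800%:R *
    (100 * 100 + 52 * 122 + v * (122 + q) + 193 * (197 + q) + 37 * (235 + q)) <=
    smith_sum jobsB [:: (0, [:: 0%N])] +
    smith_bound 122 (rcons (smith_from A jobsB 122 [:: 1; 2; 3]%N) (v, q)) -> beaten.
Proof.
move=> q0 v0 unf unfU; have [rel cost pos] := sched_B122 q0 v0.
apply: (smith_beats_OPT_rcons onA rho_gt0 lt_c (valid_jobsB R)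
  (ler0n _ _) q0 v0 _ rel cost pos _ _ unf unfU) => //.
by rewrite /= andbT ler0n.
Qed.

Lemma beaten_B175 (q v : R) (D U : seq nat) : 0 < q -> 0 <= v ->
  perm_eq (0%N :: D ++ U) (iota 0 4) ->
  unfinished jobsB [:: (0, [:: 0%N]); (100, D)] ->
  all (fun k => pr jobsB k 175 < ptime (nthjob jobsB k)) U ->
  883%:R / 800%:R *
    (100 * 100 + 193 * 175 + v * (175 + q) + 52 * (197 + q) + 37 * (235 + q)) <=
    smith_sum jobsB [:: (0, [:: 0%N]); (100, D)] +
    smith_bound 175 (rcons (smith_from A jobsB 175 U) (v, q)) -> beaten.
Proof.
move=> q0 v0 pDU unf unfU; have [rel cost pos] := sched_B175 q0 v0.
apply: (smith_beats_OPT_rcons onA rho_gt0 lt_c (valid_jobsB R)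
  (ler0n _ _) q0 v0 _ rel cost pos _ _ unf unfU) => //.
- by rewrite /= cats0.
- by rewrite /= andbT ler0n ler_nat.
Qed.

Lemma beaten_B : pr jobs0 0 100 = 38 -> beaten.
Proof.
have vB := valid_jobsB R; move=> x0.
have p100 k : pr jobsB k 100 = pr jobs0 k 100.
  apply: (online_work_cat onA (tau := 100)) => //.
  by move=> [|[]] //=; rewrite /nthjob /=; lra.
rewrite -p100 in x0.
have p0 k : (k < 4)%N -> pr jobsB k 0 = 0.
  move=> k4; apply: (progress0 onA) => //.
  by have [] := all_valid_nthjob vB k4.
have [p2 p3] : pr jobsB 2 100 = 0 /\ pr jobsB 3 100 = 0.
  by split; apply: (progress0 onA) => //; rewrite /nthjob /=; lra.
have sumB s t : s <= t -> pr jobsB 1 t + pr jobsB 2 t + pr jobsB 3 t <=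
    pr jobsB 1 s + pr jobsB 2 s + pr jobsB 3 s + (t - s).
  move=> st; have := sum_progress_le onA vB (isT : uniq [:: 1; 2; 3]%N) st.
  by rewrite !(big_cons, big_nil) !addr0 !addrA.
have mono k s t : s <= t -> pr jobsB k s <= pr jobsB k t by exact: progress_le.
have [le100 [le122 le175]] : 0 <= 100 :> R /\ 100 <= 122 :> R /\ 122 <= 175 :> R.
  by rewrite ler0n !ler_nat.
(* Job 0 used 38 of the first 100 units. *)
have hx1 : 0 <= pr jobsB 1 100 <= 62.
  rewrite progress_ge0/=.
  have := sum_progress_le onA vB (isT : uniq [:: 0; 1]%N) le100.
  by rewrite !(big_cons, big_nil) x0 !p0//; lra.
have w0 : pr jobsB 0 0 < 38 by rewrite p0// ltr0n.
have w1 : pr jobsB 1 100 < 100 by lra.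
have w3 : pr jobsB 3 100 < 22 by rewrite p3 ltr0n.
have smith0 : smith_from A jobsB 0 [:: 0%N] = [:: (37, 38)].
  by rewrite /smith_from /= p0// subr0.
have [ge10|lt10] := leP 10 (pr jobsB 2 122).
  have hy : pr jobsB 1 122 + pr jobsB 2 122 + pr jobsB 3 122 <= pr jobsB 1 100 + 22.
    by have := sumB _ _ le122; rewrite p2 p3; lra.
  have [/and3P[u1 u2 u3] le_smith] := capacity_B1 hx1
    (mono 1%N _ _ le122) ge10 (progress_ge0 A jobsB 3 122) hy.
  apply: (beaten_B122 (q := 49) (v := 180)) => //.
  - by rewrite /= /nthjob /= w0.
  - by rewrite /= /nthjob /= u1 u2 u3.
  by rewrite big_seq1 smith0.
(* 63 = 10 + (175 - 122). *)
have hz2 : 0 <= pr jobsB 2 175 <= 63.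
  rewrite progress_ge0/=.
  have := sum_progress_le onA vB (isT : uniq [:: 2]%N) le175.
  by rewrite !big_seq1; lra.
have hz1 : pr jobsB 1 100 <= pr jobsB 1 175 <= 100.
  by rewrite mono ?(le_trans le122 le175)//=; exact: (progress_le_ptime onA).
have hz3 : 0 <= pr jobsB 3 175 <= 22.
  by rewrite progress_ge0/=; exact: (progress_le_ptime onA).
have hz : pr jobsB 1 175 + pr jobsB 2 175 + pr jobsB 3 175 <= pr jobsB 1 100 + 75.
  by have := sumB _ _ (le_trans le122 le175); rewrite p2 p3; lra.
have u2 : pr jobsB 2 175 < 75 by lra.
(* A last job is released only if job 1 is complete; otherwise the instance ends with [jobsB]. *)
have [z1|z1] := eqVneq (pr jobsB 1 175) 100;
    have [z3|z3] := eqVneq (pr jobsB 3 175) 22.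
- apply: (beaten_B175 (q := 40) (v := 130) (D := [:: 1; 3]%N) (U := [:: 2%N])) => //.
  - by rewrite /= /nthjob /= w0 w1 w3.
  - by rewrite /= /nthjob /= u2.
  rewrite big_cons big_seq1 smith0.
  have -> : smith_from A jobsB 100 [:: 1; 3]%N =
      [:: (100, 100 - pr jobsB 1 100); (52, 22)].
    by rewrite /smith_from /= p3 subr0.
  exact: (capacity_B2_13 hx1 hz1 hz2 hz3 hz z1 z3).
- have u3 : pr jobsB 3 175 < 22 by rewrite lt_neqAle z3; case/andP: hz3.
  apply: (beaten_B175 (q := 26) (v := 133) (D := [:: 1%N]) (U := [:: 2; 3]%N)) => //.
  - by rewrite /= /nthjob /= w0 w1.
  - by rewrite /= /nthjob /= u2 u3.
  rewrite big_cons big_seq1 smith0.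
  exact: (capacity_B2_1 hx1 hz1 hz2 hz3 hz z1).
- have u1 : pr jobsB 1 175 < 100 by rewrite lt_neqAle z1; case/andP: hz1.
  apply: (beaten_B_stop (D := [:: 3%N]) (U := [:: 1; 2]%N)) => //.
    by rewrite /= /nthjob /= w0 w3 u1 u2.
  rewrite 2!big_cons big_seq1 [leRHS]addrA smith0.
  have -> : smith_from A jobsB 100 [:: 3%N] = [:: (52, 22)].
    by rewrite /smith_from /= p3 subr0.
  exact: (capacity_B2_3 hx1 hz1 hz2 hz3 hz z3).
- have u1 : pr jobsB 1 175 < 100 by rewrite lt_neqAle z1; case/andP: hz1.
  have u3 : pr jobsB 3 175 < 22 by rewrite lt_neqAle z3; case/andP: hz3.
  apply: (beaten_B_stop (D := [::]) (U := [:: 1; 2; 3]%N)) => //.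
    by rewrite /= /nthjob /= w0 u1 u2 u3.
  have := capacity_B2 hx1 hz1 hz2 hz3 hz.
  (* The added 0 is the bound of the empty group at date 100. *)
  by rewrite -[smith_bound 175 _]add0r 2!big_cons big_seq1 smith0.
Qed.

(** Job 0 took at least 16 units, so job 1 is unfinished at 100 as well, while running job 1 first
    completes it by then. No further job is released. *)
Lemma beaten_0 : 16 <= pr jobs0 0 38 -> pr jobs0 0 100 < 38 -> beaten.
Proof.
move=> x0 u0; have v0 := valid_jobs0 R.
have p0 k : (k < 2)%N -> pr jobs0 k 0 = 0.
  move=> k2; apply: (progress0 onA) => //.
  by have [] := all_valid_nthjob v0 k2.
have le1 : pr jobs0 0 38 <= pr jobs0 0 100 by apply: progress_le; rewrite ?ler_nat.
have pos1 : 0 <= pr jobs0 1 100 by exact: progress_ge0.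
have := sum_progress_le onA v0 (isT : uniq [:: 0; 1]%N) (ler0n R 100).
rewrite !(big_cons, big_nil) !p0// => sum1.
have u1 : pr jobs0 1 100 < 100 by lra.
have [rel cost pos] := sched_0 R.
apply: (smith_beats_OPT (gs := [:: (100, [:: 0; 1]%N)]) onA rho_gt0 lt_c v0
  _ rel cost pos) => //.
  by rewrite /= /nthjob /= u0 u1.
rewrite big_seq1.
by apply: (@smith_stop R (38 - pr jobs0 0 100) (100 - pr jobs0 1 100)); lra.
Qed.

End Adversary.

(** The constant 883/800 = 1.10375 is the least number that rounds to 1.1038, halves being rounded
    up. Beating every smaller [c] gives a ratio of at least this constant. *)
Theorem theorem4p1 (R : realType) (A : inst R -> schedule R) :
  online_algorithm A ->
  forall c : R, c < 883%:R / 800%:R ->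
    exists I : inst R, valid_inst I /\ c * OPT I < cost I (A I).
Proof.
move=> onA c lt_c.
have [x0|/ltW x0] := leP (progress A (jobs0 R) 0 38) 16.
  exact: (beaten_A onA lt_c x0).
have [e0|n0] := eqVneq (progress A (jobs0 R) 0 100) 38.
  exact: (beaten_B onA lt_c e0).
apply: (beaten_0 onA lt_c x0); rewrite lt_neqAle n0/=.
exact: (progress_le_ptime onA 100 (valid_jobs0 R) (isT : (0 < 2)%N)).
Qed.
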